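(* Let $n=2(k+1)$ for an integer $k\ge 2$, and let $\sigma_n$ be the multiset consisting of $k$ copies of $1$, one copy of $\frac{-1}{2k+1}$, and $k+1$ copies of $\frac{1-2k}{2k+1}$. Then $\sum_{\lambda\in\sigma_n}\lambda=0$ (counted with multiplicity), and $\sigma_n$ is not realizable.
   Context: A multiset $\sigma=\{\lambda_1,\dots,\lambda_n\}$ of complex numbers is realizable if there exists an $n\times n$ matrix with all entries real and nonnegative whose eigenvalues, counted with algebraic multiplicity, are exactly $\lambda_1,\dots,\lambda_n$. *)

(* Defs.v *)
From HB Require Import structures.
From mathcomp Require Import all_boot all_order all_algebra.
From mathcomp Require Import reals.
From mathcomp Require Import complex.
Set Implicit Arguments. Unset Strict Implicit. Unset Printing Implicit Defensive.
Import Order.TTheory GRing.Theory Num.Theory.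
Local Open Scope ring_scope.

(* A finite multiset of complex numbers is represented by a sequence (order
   irrelevant).  [realizable s] : there is a size(s) x size(s) matrix with real
   nonnegative entries whose eigenvalues, counted with algebraic multiplicity,
   are exactly the elements of s, i.e. whose characteristic polynomial (viewed
   over the complex numbers R[i]) splits as \prod_(l <- s) ('X - l). *)
Definition realizable (R : realType) (s : seq R[i]) : Prop :=
  exists A : 'M[R]_(size s),
    (forall i j, 0 <= A i j) /\
    map_poly (fun x : R => x%:C%C) (char_poly A) = \prod_(l <- s) ('X - l%:P).

Definition sigma (R : realType) (k : nat) : seq R[i] :=
  nseq k 1 ++ [:: (- 1 / (2 * k%:R + 1))%:C%C]
           ++ nseq k.+1 ((1 - 2 * k%:R) / (2 * k%:R + 1))%:C%C.

(* Main.v *)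
Require Import Defs.
From HB Require Import structures.
From mathcomp Require Import all_boot all_order all_algebra.
From mathcomp Require Import reals.
From mathcomp Require Import complex.
From mathcomp Require Import perm ring lra zify.
Import Order.TTheory GRing.Theory Num.Theory.
Local Open Scope ring_scope.

(** A realizing matrix has trace 0, hence zero diagonal, and so have its
    irreducible diagonal blocks, among which its spectrum is distributed.  In an
    irreducible block the eigenvalue 1 is at most simple (Perron-Frobenius).  If
    it occurs, the other eigenvalues of the block sum to -1, so they are not all
    equal to [(1 - 2k)/(2k+1)], since [(2k+1)/(2k-1)] is not an integer; the
    block thus uses the eigenvalue [-1/(2k+1)].  This is available only once,
    whereas 1 occurs [k >= 2] times.

    Let [rho > 0] be an eigenvalue of a nonnegative matrix [A] whose other
    eigenvalues [z] are nonpositive.  The product of the [A - z] is nonnegative;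
    if [v] is a nonzero row of it, then the last nonzero [v (A - rho)^d] is a
    nonnegative left eigenvector [u].  If [A] is irreducible then [u] is
    positive, and a right eigenvector for [rho] that is orthogonal to [u] must
    vanish; if [rho] were a multiple root, such an eigenvector would exist. *)

Definition has_spectrum {R : comNzRingType} {n : nat} (A : 'M[R]_n) (s : seq R) : Prop :=
  char_poly A = \prod_(z <- s) ('X - z%:P).

Lemma has_spectrum_size {R : comNzRingType} {n : nat} (A : 'M[R]_n) (s : seq R) :
  has_spectrum A s -> size s = n.
Proof.
by move=> As; apply: succn_inj; rewrite -(size_char_poly A) As size_prod_XsubC.
Qed.

Lemma has_spectrum_mxtrace {R : comNzRingType} {n : nat} (A : 'M[R]_n) (s : seq R) :
  has_spectrum A s -> \tr A = \sum_(z <- s) z.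
Proof.
move=> As; have sz := has_spectrum_size _ _ As.
case: n A As sz => [|n] A As sz.
  by rewrite (size0nil sz) big_nil /mxtrace big_ord0.
apply: oppr_inj; rewrite -char_poly_trace // As.
by rewrite -(coefPn_prod_XsubC (ps := s)) sz.
Qed.

Lemma has_spectrum_mup {F : fieldType} {n : nat} (A : 'M[F]_n) (s : seq F) (x : F) :
  has_spectrum A s -> mup x (char_poly A) = count_mem x s.
Proof. by move=> ->; apply: mu_prod_XsubC. Qed.

Lemma char_poly_lblock {R : comNzRingType} {m n : nat}
    (A : 'M[R]_m) (C : 'M[R]_(n, m)) (B : 'M[R]_n) :
  char_poly (block_mx A 0 C B) = char_poly A * char_poly B.
Proof.
rewrite /char_poly /char_poly_mx map_block_mx scalar_mx_block opp_block_mx.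
by rewrite add_block_mx map_mx0 oppr0 add0r det_lblock.
Qed.

Lemma char_poly_uconj {F : fieldType} {n : nat} (P A : 'M[F]_n) :
  P \in unitmx -> char_poly (P *m A *m invmx P) = char_poly A.
Proof.
move=> uP; have mapPV : map_mx polyC P *m map_mx polyC (invmx P) = 1%:M.
  by rewrite -map_mxM mulmxV // map_mx1.
have -> : char_poly (P *m A *m invmx P) =
    \det (map_mx polyC P *m char_poly_mx A *m map_mx polyC (invmx P)).
  rewrite /char_poly /char_poly_mx mulmxBr mulmxBl !map_mxM; congr (\det (_ - _)).
  by rewrite scalar_mxC -mulmxA mapPV mulmx1.
by rewrite !det_mulmx mulrAC -det_mulmx mapPV det1 mul1r.
Qed.

Lemma unitmx_row0_completion {F : fieldType} {n : nat} (u : 'rV[F]_n.+1) :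
  u != 0 -> exists2 P, P \in unitmx & 'e_0 *m P = u.
Proof.
move=> u0; pose e : 'rV[F]_n.+1 := 'e_0; pose U : 'M_n.+1 := \matrix_(i < n.+1) u.
have eU : e *m U = u by rewrite -rowE rowK.
have /complete_unitmx[P uP eP] : \rank (e *m U) = \rank e.
  by rewrite eU rank_rV u0 mxrank_delta.
by exists P; rewrite // -eP.
Qed.

Lemma char_poly_tr {R : comNzRingType} {n : nat} (A : 'M[R]_n) :
  char_poly A^T = char_poly A.
Proof.
rewrite /char_poly -det_tr; congr (\det _).
by apply/matrixP=> i j; rewrite !mxE eq_sym.
Qed.

Lemma col_eigenvectorP {F : fieldType} {n : nat} (A : 'M[F]_n) (a : F) :
  reflect (exists2 w : 'cV_n, w != 0 & A *m w = a *: w) (root (char_poly A) a).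
Proof.
rewrite -char_poly_tr -eigenvalue_root_char; apply: (iffP eigenvalueP).
  case=> v vA v0; exists v^T; first by rewrite trmx_eq0.
  by rewrite -[A]trmxK -trmx_mul vA linearZ.
case=> w w0 Aw; exists w^T; last by rewrite trmx_eq0.
by rewrite -trmx_mul Aw linearZ.
Qed.

Lemma block_mx_row0_scale_delta {R : nzRingType} {n : nat} (C : 'M[R]_(1 + n)) (a : R) :
  row 0 C = a *: 'e_0 -> C = block_mx a%:M 0 (dlsubmx C) (drsubmx C).
Proof.
move=> /rowP rowC; rewrite -[LHS]submxK; congr block_mx; apply/matrixP=> i j.
  move: (rowC (lshift n j)); rewrite !ord1 !mxE /= mulr1 => <-.
  by congr (C _ _); apply: val_inj.
move: (rowC (rshift 1 j)); rewrite !ord1 !mxE /= mulr0 => <-.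
by congr (C _ _); apply: val_inj.
Qed.

(* In a basis of row vectors starting with [u] the matrix is block triangular,
   with first diagonal block [a]; a multiple eigenvalue [a] is thus one of the
   other block as well. *)
Lemma multiple_eigenvalue_orthogonal_eigenvector {F : fieldType} {n : nat} (A : 'M[F]_n)
    (u : 'rV_n) (a : F) :
  u != 0 -> u *m A = a *: u -> (1 < mup a (char_poly A))%N ->
  exists w : 'cV_n, [/\ w != 0, A *m w = a *: w & u *m w = 0].
Proof.
case: n => [|n] in A u *; first by rewrite thinmx0 eqxx.
move=> /unitmx_row0_completion[P uP eP] uA.
rewrite -(char_poly_uconj _ _ uP); set C : 'M_(1 + n) := P *m A *m invmx P.
have rowC : row 0 C = a *: 'e_0.
  by rewrite rowE /C !mulmxA eP uA -scalemxAl -eP mulmxK.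
have CE := block_mx_row0_scale_delta _ _ rowC.
have -> : char_poly C = ('X - a%:P) * char_poly (drsubmx C).
  by rewrite [in LHS]CE char_poly_lblock {1}/char_poly det_mx11 !mxE.
rewrite mupM ?monic_neq0 ?monicXsubC ?char_poly_monic //.
rewrite -['X - _]expr1 mup_XsubCX eqxx add1n ltnS.
rewrite -XsubC_dvd ?monic_neq0 ?char_poly_monic // dvdp_XsubCl.
case/col_eigenvectorP=> v v0 Bv.
pose z : 'cV_(1 + n) := col_mx 0 v.
have Cz : C *m z = a *: z.
  by rewrite CE mul_block_col !mulmx0 mul0mx !add0r Bv scale_col_mx scaler0.
exists (invmx P *m z); split.
- apply: contraNneq v0 => Pz0; have /eqP : z = 0 by rewrite -(mulKVmx uP z) Pz0 mulmx0.
  by rewrite col_mx_eq0 eqxx.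
- by rewrite scalemxAr -Cz /C -!mulmxA mulKmx.
- rewrite -eP -mulmxA mulKVmx //; apply/rowP=> j.
  by rewrite -rowE !mxE; case: splitP => // k; rewrite mxE.
Qed.

Lemma mxOver_tr {T : Type} {m n : nat} (S : {pred T}) (A : 'M_(m, n)) :
  A \is a mxOver S -> A^T \is a mxOver S.
Proof. by move=> /mxOverP AS; apply/mxOverP=> i j; rewrite mxE. Qed.

Lemma mxOver_mxsub {T : Type} {m n p q : nat} (S : {pred T}) (A : 'M_(m, n))
    (f : 'I_p -> 'I_m) (g : 'I_q -> 'I_n) :
  A \is a mxOver S -> mxsub f g A \is a mxOver S.
Proof. by move=> /mxOverP AS; apply/mxOverP=> i j; rewrite mxE. Qed.

Definition absorbing_set {R : nmodType} {n : nat} (A : 'M[R]_n) (S : {set 'I_n}) : bool :=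
  [forall i in S, forall j in ~: S, A i j == 0].

Definition irreducible_mx {R : nmodType} {n : nat} (A : 'M[R]_n) : bool :=
  [forall S : {set 'I_n}, absorbing_set A S ==> (S == set0) || (S == setT)].

Lemma absorbing_setP {R : nmodType} {n : nat} (A : 'M[R]_n) (S : {set 'I_n}) :
  reflect {in S & ~: S, forall i j, A i j = 0} (absorbing_set A S).
Proof.
apply: (iffP 'forall_in_'forall_in_eqP) => AS i; first by move=> j iS; apply: AS.
by move=> iS j; apply: AS.
Qed.

Lemma irreducible_mxP {R : nmodType} {n : nat} (A : 'M[R]_n) :
  reflect (forall S, absorbing_set A S -> S = set0 \/ S = setT) (irreducible_mx A).
Proof.
apply: (iffP forallP) => irrA S.
  by move: (irrA S) => /implyP/[apply] /orP[]/eqP; [left|right].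
by apply/implyP=> /irrA[]->; rewrite eqxx ?orbT.
Qed.

Lemma irreducible_mx_tr {R : nmodType} {n : nat} (A : 'M[R]_n) :
  irreducible_mx A -> irreducible_mx A^T.
Proof.
move=> /irreducible_mxP irrA; apply/irreducible_mxP=> S /absorbing_setP AS.
have /irrA[SC|SC] : absorbing_set A (~: S).
- apply/absorbing_setP=> i j; rewrite setCK => iS jS.
  by rewrite -[RHS](AS j i) // mxE.
- by right; rewrite -[S]setCK SC setC0.
- by left; rewrite -[S]setCK SC setCT.
Qed.

Lemma irreducible_eigenvector_gt0 {R : numDomainType} {n : nat} (A : 'M[R]_n)
    (w : 'cV_n) (rho : R) :
  irreducible_mx A -> A \is a mxOver Num.nneg -> w \is a mxOver Num.nneg ->
  w != 0 -> A *m w = rho *: w -> w \is a mxOver Num.pos.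
Proof.
move=> /irreducible_mxP irrA /mxOverP A_ge0 /mxOverP w_ge0 w_neq0 Aw.
pose Z := [set i | w i 0 == 0].
have /irrA[Z0|ZT] : absorbing_set A Z.
- apply/absorbing_setP=> i j; rewrite !inE => /eqP wi wj.
  move/matrixP/(_ i 0)/eqP: Aw; rewrite !mxE wi mulr0.
  rewrite psumr_eq0 => [/allP/(_ j)|k _]; last exact: mulr_ge0 (A_ge0 _ _) (w_ge0 _ _).
  by rewrite mem_index_enum mulf_eq0 (negPf wj) orbF => /(_ isT)/eqP.
- apply/mxOverP=> i j; rewrite ord1 posrE lt0r [_ <= _]w_ge0 andbT.
  by have := in_set0 i; rewrite -Z0 inE => ->.
- case/eqP: w_neq0; apply/colP=> i; rewrite mxE; apply/eqP.
  by have := in_setT i; rewrite -ZT inE.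
Qed.

Lemma pos_mulmx_nneg_eq0 {R : numDomainType} {n : nat} (u : 'rV[R]_n) (v : 'cV_n) :
  u \is a mxOver Num.pos -> v \is a mxOver Num.nneg -> u *m v = 0 -> v = 0.
Proof.
move=> /mxOverP u_gt0 /mxOverP v_ge0 /matrixP/(_ 0 0)/eqP; rewrite !mxE.
have entry_gt0 i : 0 < u 0 i by rewrite -posrE.
rewrite psumr_eq0 => [/allP uv0|i _]; last exact: mulr_ge0 (ltW _) (v_ge0 _ _).
apply/colP=> i; rewrite mxE; apply/eqP; have := uv0 i (mem_index_enum _).
by rewrite mulf_eq0 gt_eqF.
Qed.

(* Pairing [A |w| - rho |w| >= 0] with [u > 0] shows that [|w|], hence also
   [|w| + w], is an eigenvector; if nonzero the latter is positive, and so is [w]. *)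
Lemma irreducible_orthogonal_eigenvector_eq0 {R : realDomainType} {n : nat} (A : 'M[R]_n)
    (u : 'rV_n) (w : 'cV_n) (rho : R) :
  irreducible_mx A -> A \is a mxOver Num.nneg -> u \is a mxOver Num.pos -> 0 <= rho ->
  u *m A = rho *: u -> A *m w = rho *: w -> u *m w = 0 -> w = 0.
Proof.
move=> irrA A_ge0 u_gt0 rho_ge0 uA Aw uw; pose a := map_mx Num.norm w.
have a_eq0 : a = 0 -> w = 0.
  by move=> /matrixP a0; apply/matrixP=> i j; have := a0 i j; rewrite !mxE => /normr0_eq0.
have Aa : A *m a = rho *: a.
  apply/eqP; rewrite -subr_eq0; apply/eqP/(pos_mulmx_nneg_eq0 _ _ u_gt0).
    apply/mxOverP=> i j; have := congr1 (fun v : 'cV_n => `|v i j|) Aw.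
    rewrite !mxE nnegrE subr_ge0 normrM (ger0_norm rho_ge0) => <-.
    apply: le_trans (ler_norm_sum _ _ _) _; apply: ler_sum => k _.
    by rewrite !mxE normrM ger0_norm // -nnegrE (mxOverP A_ge0).
  by rewrite mulmxBr mulmxA uA -scalemxAl -scalemxAr subrr.
have ua_p : u *m (a + w) = u *m a by rewrite mulmxDr uw addr0.
have p_ge0 : a + w \is a mxOver Num.nneg.
  by apply/mxOverP=> i j; rewrite !mxE nnegrE -lerBlDr sub0r -normrN ler_norm.
have a_ge0 : a \is a mxOver Num.nneg by apply/mxOverP=> i j; rewrite mxE nnegrE.
have [p_eq0|p_neq0] := eqVneq (a + w) 0.
  by apply/a_eq0/(pos_mulmx_nneg_eq0 _ _ u_gt0 a_ge0); rewrite -ua_p p_eq0 mulmx0.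
apply: (pos_mulmx_nneg_eq0 _ _ u_gt0 _ uw); apply/mxOverP=> i j.
have Ap : A *m (a + w) = rho *: (a + w) by rewrite mulmxDr Aa Aw scalerDr.
have /mxOverP/(_ i j) := irreducible_eigenvector_gt0 _ _ _ irrA A_ge0 p_ge0 p_neq0 Ap.
rewrite !mxE posrE nnegrE leNgt; apply: contraTN => w_lt0.
by rewrite ltr0_norm // addNr ltxx.
Qed.

Definition forward_diff {R : zmodType} (f : nat -> R) (n : nat) : R := f n.+1 - f n.

Lemma eventually_le_of_forward_diff {R : archiRealFieldType} (f : nat -> R) (c : R) :
  c < 0 -> (exists N, forall n, (N <= n)%N -> forward_diff f n <= c) ->
  exists N, forall n, (N <= n)%N -> f n <= c.
Proof.
move=> c_lt0 [N dfN]; have descent k : f (N + k)%N <= f N + c *+ k.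
  elim: k => [|k IH]; first by rewrite addn0 addr0.
  rewrite addnS mulrSr addrA -[f _.+1](subrK (f (N + k)%N)).
  by rewrite [leRHS]addrC; apply: lerD (dfN _ (leq_addr _ _)) IH.
pose K := (Num.truncn (f N / - c)).+1.
have fN_le : f N <= - (c *+ K).
  by rewrite -mulNrn -mulr_natl -ler_pdivrMr ?oppr_gt0 // ltW // truncnS_gt.
exists (N + K.+1)%N => n /subnKC <-; rewrite -addnA.
apply: le_trans (descent _) _; rewrite addSn mulrSr addrA mulrnDr.
have : c *+ (n - (N + K.+1)) <= 0 by rewrite mulrn_wle0 // ltW.
lra.
Qed.

Lemma const_iter_forward_diff_ge0 {R : archiRealFieldType} (f : nat -> R) (d : nat) (c : R) :
  (forall n, 0 <= f n) -> (forall n, iter d forward_diff f n = c) -> 0 <= c.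
Proof.
move=> f_ge0 dfE; rewrite leNgt; apply/negP=> c_lt0.
have [N fN] : exists N, forall n, (N <= n)%N -> f n <= c.
  have : exists N, forall n, (N <= n)%N -> iter d forward_diff f n <= c.
    by exists 0 => n _; rewrite dfE.
  by elim: d {dfE} => // d IH /(eventually_le_of_forward_diff _ _ c_lt0).
by have := le_lt_trans (le_trans (f_ge0 N) (fN N (leqnn N))) c_lt0; rewrite ltxx.
Qed.

(* Let [d] be the last exponent with [v (A - 1)^d != 0].  Its entries are the
   [d]-th differences, constant in [M], of the entries of [v A^M >= 0]. *)
Lemma nneg_left_fixed_of_generalized {R : archiRealFieldType} {n : nat} (A : 'M[R]_n)
    (v : 'rV_n) (m : nat) :
  A \is a mxOver Num.nneg -> v \is a mxOver Num.nneg -> v != 0 ->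
  v *m (A - 1) ^+ m = 0 ->
  exists u : 'rV_n, [/\ u \is a mxOver Num.nneg, u != 0 & u *m A = u].
Proof.
move=> A_ge0 v_ge0 v_neq0 vm0.
have vanishing : exists m, v *m (A - 1) ^+ m == 0 by exists m; apply/eqP.
case: (ex_minnP vanishing) => -[|d] /eqP vd0 dmin.
  by case/eqP: v_neq0; rewrite -vd0 mulmx1.
pose u := v *m (A - 1) ^+ d.
have uA : u *m A = u.
  by apply/eqP; rewrite -subr_eq0 -[X in _ - X]mulmx1 -mulmxBr -mulmxA mulmxE -exprSr vd0.
exists u; split=> //; last by apply/negP=> /dmin; rewrite ltnn.
apply/mxOverP=> i j; rewrite nnegrE.
have diffE k M : iter k forward_diff (fun M => (v *m A ^+ M) i j) M =
    (v *m (A - 1) ^+ k *m A ^+ M) i j.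
  elim: k M => [|k IH] M; first by rewrite mulmx1.
  rewrite iterS /forward_diff !IH exprS exprSr -!mulmxE.
  by rewrite !mulmxBr mulmx1 mulmxBl !mulmxA !mxE.
apply: (@const_iter_forward_diff_ge0 _ (fun M => (v *m A ^+ M) i j) d) => M.
  by rewrite -nnegrE; apply/mxOverP/mxOverM/rpredX.
by rewrite diffE; elim: M => [|M IH]; rewrite ?mulmx1 // exprS -mulmxE mulmxA uA.
Qed.

Lemma nneg_left_eigenvector_of_generalized {R : archiRealFieldType} {n : nat} (A : 'M[R]_n)
    (v : 'rV_n) (rho : R) (m : nat) :
  0 < rho -> A \is a mxOver Num.nneg -> v \is a mxOver Num.nneg -> v != 0 ->
  v *m (A - rho%:M) ^+ m = 0 ->
  exists u : 'rV_n, [/\ u \is a mxOver Num.nneg, u != 0 & u *m A = rho *: u].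
Proof.
case: n => [|n] in A v *; first by move=> _ _ _; rewrite thinmx0 eqxx.
move=> rho_gt0 A_ge0 v_ge0 v_neq0 vm0; pose B := rho^-1 *: A.
have AE : A = rho *: B by rewrite scalerA divff ?scale1r // gt_eqF.
have BE : B - 1 = rho^-1 *: (A - rho%:M).
  by rewrite scalerBr scale_scalar_mx mulVf // gt_eqF.
have [||u [u_ge0 u_neq0 uB]] := nneg_left_fixed_of_generalized B v m _ v_ge0 v_neq0.
- by apply: mxOverZ => //; rewrite nnegrE invr_ge0 ltW.
- by rewrite BE exprZn -scalemxAr vm0 scaler0.
by exists u; rewrite AE -scalemxAr uB.
Qed.

Lemma horner_mx_prod_nneg {R : numDomainType} {n : nat} (A : 'M[R]_n.+1) (t : seq R) :
  A \is a mxOver Num.nneg -> {in t, forall x : R, x <= 0} ->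
  horner_mx A (\prod_(x <- t) ('X - x%:P)) \is a mxOver Num.nneg.
Proof.
move=> A_ge0 t_le0; rewrite rmorph_prod big_seq.
apply: (big_ind (fun M => M \is a mxOver Num.nneg)) => [|B C|x xt].
- by apply: mxOver_scalar; rewrite nnegrE ?ler01.
- exact: mxOverM.
apply/mxOverP=> i j; rewrite rmorphB /= horner_mx_X horner_mx_C !mxE nnegrE subr_ge0.
by rewrite (@le_trans _ _ 0) ?mulrn_wle0 ?t_le0 // -nnegrE (mxOverP A_ge0).
Qed.

Lemma nneg_left_eigenvector_of_spectrum {R : archiRealFieldType} {n : nat} (A : 'M[R]_n)
    (s : seq R) (rho : R) :
  0 < rho -> A \is a mxOver Num.nneg -> has_spectrum A s -> rho \in s ->
  {in s, forall z : R, z = rho \/ z <= 0} ->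
  exists u : 'rV_n, [/\ u \is a mxOver Num.nneg, u != 0 & u *m A = rho *: u].
Proof.
case: n => [|n] in A *.
  by move=> _ _ /has_spectrum_size/size0nil->.
move=> rho_gt0 A_ge0 As rhos s_le0.
pose h : {poly R} := \prod_(z <- s | z != rho) ('X - z%:P).
have chA : char_poly A = ('X - rho%:P) ^+ count_mem rho s * h.
  rewrite As (bigID (pred1 rho)) /=; congr (_ * _).
  by rewrite -big_filter (all_pred1P _ _ (filter_all _ _)) size_filter big_nseq iter_mulr_1.
have h_nneg : horner_mx A h \is a mxOver Num.nneg.
  rewrite /h -big_filter; apply: horner_mx_prod_nneg => // z.
  by rewrite mem_filter => /andP[/negP zrho /s_le0[/eqP|]].
have /matrix0Pn[i [j hij]] : horner_mx A h != 0.
  apply/eqP=> /mxminpoly_min/root_dvdp hroot; have /hroot : root (mxminpoly A) rho.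
    by rewrite -eigenvalue_root_min eigenvalue_root_char As root_prod_XsubC.
  by rewrite /h -big_filter root_prod_XsubC mem_filter eqxx.
pose v := row i (horner_mx A h).
apply: (nneg_left_eigenvector_of_generalized _ v _ (count_mem rho s)) => //.
- by apply/mxOverP=> a b; rewrite mxE; apply/mxOverP.
- by apply/matrix0Pn; exists 0, j; rewrite mxE.
- have -> : A - rho%:M = horner_mx A ('X - rho%:P).
    by rewrite rmorphB /= horner_mx_X horner_mx_C.
  by rewrite -row_mul -rmorphXn mulmxE -rmorphM mulrC -chA /= Cayley_Hamilton row0.
Qed.

Lemma irreducible_eigenvalue_count_le1 {R : archiRealFieldType} {n : nat} (A : 'M[R]_n)
    (s : seq R) (rho : R) :
  0 < rho -> irreducible_mx A -> A \is a mxOver Num.nneg -> has_spectrum A s ->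
  {in s, forall z : R, z = rho \/ z <= 0} -> (count_mem rho s <= 1)%N.
Proof.
move=> rho_gt0 irrA A_ge0 As s_le0; rewrite leqNgt; apply/negP=> rho_multiple.
have rhos : rho \in s by rewrite -has_pred1 has_count ltnW.
have [u [u_ge0 u_neq0 uA]] :=
  nneg_left_eigenvector_of_spectrum _ _ _ rho_gt0 A_ge0 As rhos s_le0.
have u_gt0 : u \is a mxOver Num.pos.
  rewrite -[u]trmxK; apply/mxOver_tr/(irreducible_eigenvector_gt0 A^T _ rho).
  - exact: irreducible_mx_tr.
  - exact: mxOver_tr.
  - exact: mxOver_tr.
  - by rewrite trmx_eq0.
  - by rewrite -trmx_mul uA linearZ.
rewrite -(has_spectrum_mup _ _ _ As) in rho_multiple.
have [w [w_neq0 Aw uw]] :=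
  multiple_eigenvalue_orthogonal_eigenvector _ _ _ u_neq0 uA rho_multiple.
case/eqP: w_neq0.
exact: irreducible_orthogonal_eigenvector_eq0 irrA A_ge0 u_gt0 (ltW rho_gt0) uA Aw uw.
Qed.

Lemma det_mxsub_bij {R : comNzRingType} {m n : nat} (f : 'I_m -> 'I_n) (A : 'M[R]_n) :
  bijective f -> \det (mxsub f f A) = \det A.
Proof.
move=> bf; have mn : m = n by rewrite -(card_ord m) (bij_eq_card bf) card_ord.
case: _ / mn f A bf => f A /bij_inj injf.
have -> : mxsub f f A = row_perm (perm injf) (col_perm (perm injf) A).
  by apply/matrixP=> i j; rewrite !mxE !permE.
rewrite row_permE col_permE !det_mulmx !det_perm.
by rewrite mulrCA odd_permV -signr_addb addbb mulr1.
Qed.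

Lemma char_poly_mxsub_bij {R : comNzRingType} {m n : nat} (f : 'I_m -> 'I_n)
    (A : 'M[R]_n) :
  bijective f -> char_poly (mxsub f f A) = char_poly A.
Proof.
move=> bf; rewrite /char_poly -[RHS](det_mxsub_bij _ _ bf); congr (\det _).
by apply/matrixP=> i j; rewrite !mxE (inj_eq (bij_inj bf)).
Qed.

Definition set_val {n : nat} (S : {set 'I_n}) : 'I_#|S| -> 'I_n := @enum_val _ (mem S).

Definition principal_mx {R : Type} {n : nat} (S : {set 'I_n}) (A : 'M[R]_n) : 'M[R]_#|S| :=
  mxsub (set_val S) (set_val S) A.

Definition setC_split_val {n : nat} (S : {set 'I_n}) (i : 'I_(#|S| + #|~: S|)) : 'I_n :=
  match split i with inl j => set_val S j | inr j => set_val (~: S) j end.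

Lemma setC_split_val_lshift {n : nat} (S : {set 'I_n}) (i : 'I_#|S|) :
  setC_split_val S (lshift _ i) = set_val S i.
Proof. by rewrite /setC_split_val -[lshift _ _]/(unsplit (inl i)) unsplitK. Qed.

Lemma setC_split_val_rshift {n : nat} (S : {set 'I_n}) (i : 'I_#|~: S|) :
  setC_split_val S (rshift _ i) = set_val (~: S) i.
Proof. by rewrite /setC_split_val -[rshift _ _]/(unsplit (inr i)) unsplitK. Qed.

Lemma setC_split_val_bij {n : nat} (S : {set 'I_n}) : bijective (setC_split_val S).
Proof.
apply: inj_card_bij; last by rewrite !card_ord cardsC card_ord.
have disj (i : 'I_#|S|) (j : 'I_#|~: S|) : set_val S i <> set_val (~: S) j.
  by move=> ij; have := enum_valP j; rewrite inE -[enum_val j]ij enum_valP.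
move=> i j; case: (split_ordP i) => {}i ->; case: (split_ordP j) => {}j ->;
  rewrite ?setC_split_val_lshift ?setC_split_val_rshift.
- by move/enum_val_inj->.
- by move/disj.
- by move/esym/disj.
- by move/enum_val_inj->.
Qed.

Lemma char_poly_absorbing_set {R : comNzRingType} {n : nat} (A : 'M[R]_n) (S : {set 'I_n}) :
  absorbing_set A S ->
  char_poly A = char_poly (principal_mx S A) * char_poly (principal_mx (~: S) A).
Proof.
move=> /absorbing_setP AS; pose f := setC_split_val S.
rewrite -(char_poly_mxsub_bij _ _ (setC_split_val_bij S)) -[mxsub _ _ A]submxK.
have -> : ursubmx (mxsub f f A) = 0.
  apply/matrixP=> i j; rewrite !mxE /f setC_split_val_lshift setC_split_val_rshift.
  by apply: AS; apply: enum_valP.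
rewrite char_poly_lblock; congr (_ * _); congr char_poly; apply/matrixP=> i j.
  by rewrite !mxE !setC_split_val_lshift.
by rewrite !mxE !setC_split_val_rshift.
Qed.

Lemma irreducible_block_ind {R : nmodType} (P : forall n, 'M[R]_n -> Prop) :
  (forall n (A : 'M_n), irreducible_mx A -> P n A) ->
  (forall n (A : 'M_n) S, absorbing_set A S ->
     P _ (principal_mx S A) -> P _ (principal_mx (~: S) A) -> P n A) ->
  forall n (A : 'M_n), P n A.
Proof.
move=> P_irr P_block; elim/ltn_ind=> n IH A.
have [/P_irr//|] := boolP (irreducible_mx A).
case/forallPn=> S; rewrite negb_imply negb_or => /and3P[AS S0 ST].
have card_lt (T : {set 'I_n}) : T != setT -> (#|T| < n)%N.
  by move=> TT; rewrite -[n in (_ < n)%N]card_ord -cardsT proper_card // properT.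
apply: (P_block _ _ _ AS); apply/IH/card_lt => //.
by apply: contraNneq S0 => SC; rewrite -[S]setCK SC setCT.
Qed.

Lemma has_spectrum_mulP {F : fieldType} {m n p : nat} (A : 'M[F]_m) (B : 'M[F]_n)
    (C : 'M[F]_p) (s : seq F) :
  char_poly A = char_poly B * char_poly C -> has_spectrum A s ->
  exists t u, [/\ has_spectrum B t, has_spectrum C u & perm_eq s (t ++ u)].
Proof.
have splits k (M : 'M[F]_k) : char_poly M %| char_poly A -> has_spectrum A s ->
    exists t, has_spectrum M t.
  move=> MA As; move: MA; rewrite As => /dvdp_prod_XsubC[b bE]; exists (mask b s).
  by apply/eqP; rewrite -eqp_monic ?char_poly_monic ?monic_prod_XsubC.
move=> chA As; have [|t Bt] := splits _ B _ As; first by rewrite chA dvdp_mulr.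
have [|u Cu] := splits _ C _ As; first by rewrite chA dvdp_mull.
exists t, u; split=> //; apply: prod_XsubC_eq.
by rewrite -As chA big_cat Bt Cu.
Qed.

Lemma nneg_mxtrace0_diag {R : numDomainType} {n : nat} (A : 'M[R]_n) :
  A \is a mxOver Num.nneg -> \tr A = 0 -> forall i, A i i = 0.
Proof.
move=> /mxOverP A_ge0 /eqP; rewrite psumr_eq0 => [/allP trA i|i _]; last exact: A_ge0.
by apply/eqP; apply: trA; rewrite mem_index_enum.
Qed.

Section ZeroDiagonal.
Context {R : archiRealFieldType}.
Variables rho y : R.
Hypotheses (rho_gt0 : 0 < rho) (rho_y_neq0 : forall q : nat, rho + y *+ q != 0).

Lemma irreducible_trace0_count_le {n : nat} (A : 'M[R]_n) (s : seq R) :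
  irreducible_mx A -> A \is a mxOver Num.nneg -> \tr A = 0 -> has_spectrum A s ->
  {in s, forall z : R, z = rho \/ z <= 0} ->
  (count_mem rho s <= count (predC (pred2 rho y)) s)%N.
Proof.
move=> irrA A_ge0 trA As s_le0; rewrite leqNgt; apply/negP=> count_lt.
have count_rho : count_mem rho s = 1%N.
  apply/eqP; rewrite eqn_leq (irreducible_eigenvalue_count_le1 _ _ _ rho_gt0 irrA A_ge0 As) //.
  exact: leq_ltn_trans count_lt.
have s_rho_y : all (pred2 rho y) s.
  rewrite all_count -(count_predC (pred2 rho y) s) eq_sym -[eqbRHS]addn0 eqn_add2l.
  by rewrite -leqn0 -ltnS -count_rho.
have : rho + y *+ count (predC1 rho) s = 0.
  rewrite -trA (has_spectrum_mxtrace _ _ As) (bigID (pred1 rho)) /=.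
  rewrite (eq_bigr (fun=> rho)) => [|z /eqP//].
  rewrite [in RHS]big_const_seq count_rho /= addr0; congr (_ + _).
  rewrite big_seq_cond (eq_bigr (fun=> y)) -?big_seq_cond => [|z /andP[zs zrho]].
    by rewrite big_const_seq iter_addr_0.
  by have := allP s_rho_y z zs; rewrite /= (negPf zrho) => /eqP.
by apply/eqP.
Qed.

Lemma zero_diag_count_le {n : nat} (A : 'M[R]_n) (s : seq R) :
  A \is a mxOver Num.nneg -> (forall i, A i i = 0) -> has_spectrum A s ->
  {in s, forall z : R, z = rho \/ z <= 0} ->
  (count_mem rho s <= count (predC (pred2 rho y)) s)%N.
Proof.
elim/(@irreducible_block_ind R): n / A s =>
    [n A irrA|n A S AS IHS IHSC] s A_ge0 diagA As s_le0.
  by apply: (irreducible_trace0_count_le A) => //; apply: big1.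
have [t [u [St SCu stu]]] := has_spectrum_mulP _ _ _ _ (char_poly_absorbing_set _ _ AS) As.
have /seq.permP count_stu := stu; rewrite !count_stu !count_cat.
apply: leq_add; [apply: IHS | apply: IHSC] => //; try exact: mxOver_mxsub.
- by move=> i; rewrite mxE.
- by move=> z zt; apply: s_le0; rewrite (perm_mem stu) mem_cat zt.
- by move=> i; rewrite mxE.
- by move=> z zu; apply: s_le0; rewrite (perm_mem stu) mem_cat zu orbT.
Qed.

End ZeroDiagonal.

Lemma realizable_real {R : realType} (s : seq R) :
  realizable [seq z%:C%C | z <- s] ->
  exists n (A : 'M[R]_n), A \is a mxOver Num.nneg /\ has_spectrum A s.
Proof.
case=> A [A_ge0 chA]; exists (size [seq z%:C%C | z <- s]), A; split.
  by apply/mxOverP.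
apply: (map_poly_inj (real_complex R)).
by rewrite [LHS]chA big_map map_prod_XsubC.
Qed.

Definition sigma_min (R : realFieldType) (k : nat) : R :=
  (1 - 2 * k%:R) / (2 * k%:R + 1).

Definition real_sigma (R : realFieldType) (k : nat) : seq R :=
  nseq k 1 ++ - 1 / (2 * k%:R + 1) :: nseq k.+1 (sigma_min R k).

Lemma sigma_real {R : realType} (k : nat) :
  sigma R k = [seq z%:C%C | z <- real_sigma R k].
Proof. by rewrite map_cat /= !map_nseq. Qed.

Lemma sum_real_sigma {R : realFieldType} (k : nat) : \sum_(z <- real_sigma R k) z = 0.
Proof.
rewrite big_cat big_cons !big_nseq !iter_addr_0 /= -[_ *+ k.+1]mulr_natr -natr1 /sigma_min.
by field; rewrite gt_eqF // ltr_wpDl ?mulr_ge0.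
Qed.

Lemma real_sigma_eq1_or_le0 {R : realFieldType} (k : nat) :
  (0 < k)%N -> {in real_sigma R k, forall z : R, z = 1 \/ z <= 0}.
Proof.
move=> k_gt0 z; have k1 : (1 : R) <= k%:R by rewrite ler1n.
rewrite mem_cat inE !mem_nseq => /or3P[/andP[_ /eqP]|/eqP->|/andP[_ /eqP->]]; [by left| |].
all: by right; rewrite pmulr_lle0 ?invr_gt0; lra.
Qed.

Lemma count_real_sigma_lt {R : realFieldType} (k : nat) :
  (1 < k)%N ->
  (count (predC (pred2 1%R (sigma_min R k))) (real_sigma R k) <
   count_mem 1%R (real_sigma R k))%N.
Proof.
move=> k_gt1; rewrite !count_cat /= !count_nseq /= !eqxx orbT mul1n /= !addn0 add0n.
by apply: leq_ltn_trans (leq_b1 _) (leq_trans k_gt1 (leq_addr _ _)).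
Qed.

(* Otherwise [2k - 1] would divide [2k + 1], hence [2]. *)
Lemma one_add_natmul_sigma_min_neq0 {R : realFieldType} (k q : nat) :
  (1 < k)%N -> 1 + sigma_min R k *+ q != 0.
Proof.
move=> k_gt1; have den0 : 2 * k%:R + 1 != 0 :> R by rewrite gt_eqF // ltr_wpDl ?mulr_ge0.
apply/eqP=> sum0; have : (2 * k + 1 + q)%:R = (q * (2 * k))%:R :> R.
  apply/eqP; rewrite -subr_eq0 -[eqbRHS](mulr0 (2 * k%:R + 1)) -sum0.
  by rewrite -mulr_natr !natrD !natrM /sigma_min; apply/eqP; field.
move/eqP; rewrite eqr_nat => /eqP; case: q {sum0} => [|[|q]]; nia.
Qed.

Theorem theorem3 (R : realType) (k : nat) (hk : (2 <= k)%N) :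
  size (sigma R k) = (2 * k.+1)%N /\
  \sum_(l <- sigma R k) l = 0 /\ ~ realizable (sigma R k).
Proof.
rewrite sigma_real; split; first by rewrite size_map size_cat /= !size_nseq; lia.
split; first by rewrite big_map -(rmorph_sum (real_complex R)) sum_real_sigma.
case/realizable_real=> n [A [A_ge0 As]].
have trA : \tr A = 0 by rewrite (has_spectrum_mxtrace _ _ As) sum_real_sigma.
have sum_neq0 (q : nat) : 1 + sigma_min R k *+ q != 0.
  exact: one_add_natmul_sigma_min_neq0.
have := zero_diag_count_le _ _ ltr01 sum_neq0 _ _ A_ge0 (nneg_mxtrace0_diag _ A_ge0 trA)
  As (real_sigma_eq1_or_le0 _ (ltnW hk)).
by rewrite leqNgt count_real_sigma_lt.
Qed.
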